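(* Let $X$ be a compactum. There is a natural bijection between the set of equivalence classes of overlay structures on a covering map $p\colon\tilde X\to X$ and the set of uniformities on $\tilde X$ agreeing with $p$.
   Context: A compactum is a compact metrizable space. Covers are open covers. A covering map is a map $p\colon\tilde X\to X$ for which there is a cover $\{U_\alpha\}$ of $X$ such that (i) each $p^{-1}(U_\alpha)=\bigsqcup_\lambda U_\alpha^\lambda$, where each $p|_{U_\alpha^\lambda}$ is a homeomorphism onto $U_\alpha$; then the cover $\{U_\alpha^\lambda\}$ of $\tilde X$ is said to lie over $\{U_\alpha\}$. An overlay structure on $p$ is a cover $\{U_\alpha^\lambda\}$ of $\tilde X$ lying over some cover of $X$ and additionally satisfying (ii) if $U_\alpha^\lambda\cap U_\beta^\mu$ and $U_\alpha^\lambda\cap U_\beta^\nu$ are both nonempty, then $\mu=\nu$. Two overlay structures on $p$ are equivalent if there exists an overlay structure on $p$ refining each of them (as covers of $\tilde X$). A uniformity (uniform structure) on $\tilde X$ agrees with the covering map $p$ if every $x\in X$ has a closed neighborhood $U$ such that (iii) $p^{-1}(U)=\bigsqcup_\lambda U^\lambda$ as uniform spaces, where each $p|_{U^\lambda}$ is a homeomorphism. An equivalent way of formulating (iii) is: $p^{-1}(U)$ is uniformly homeomorphic to $U\times F$, where $F$ is discrete as a uniform space (not merely as a topological space), by a homeomorphism $h$ such that $ph^{-1}\colon U\times F\to U$ is the projection.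
   Formalization: A uniformity agreeing with p is additionally required to make p uniformly continuous; without this the claim fails, e.g. for [0,1]×ℕ → [0,1], which has one overlay class but several uniformities satisfying (iii). *)

(* Defs.v *)
(* MathComp-Analysis *)
From HB Require Import structures.
From mathcomp Require Import all_boot all_order all_algebra.
From mathcomp Require Import all_classical all_reals all_analysis.

Set Implicit Arguments.
Unset Strict Implicit.
Unset Printing Implicit Defensive.

Local Open Scope classical_set_scope.

(* [f] restricts to a homeomorphism of the subspace [A] onto the subspace [B];
   [A] and [B] are used as types carrying the subspace topology. *)
Definition restricts_to_homeo (S T : topologicalType) (f : S -> T)
    (A : set S) (B : set T) : Prop :=
  exists (h : A -> B) (k : B -> A),
    [/\ continuous h, continuous k, cancel h k, cancel k h &
        forall a : A, val (h a) = f (val a)].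

(* The open family [V i l], [l : L i], lies over the open cover [U i] of [X]:
   the preimage of [U i] is the disjoint union of the sheets [V i l]. *)
Definition lies_over (T X : topologicalType) (p : T -> X) (I : Type)
    (U : I -> set X) (L : I -> Type) (V : forall i, L i -> set T) : Prop :=
  [/\ (forall i, open (U i)) /\ \bigcup_i U i = [set: X],
      forall i l, open (V i l),
      forall i, p @^-1` U i = \bigcup_l V i l,
      forall i, trivIset [set: L i] (V i) &
      forall i l, restricts_to_homeo p (V i l) (U i)].

Definition covering_map (T X : topologicalType) (p : T -> X) : Prop :=
  continuous p /\
  exists (I : Type) (U : I -> set X) (L : I -> Type)
    (V : forall i, L i -> set T), lies_over p U V.

(* A cover of [T] is the set of its members.  Equivalence of overlay structures
   only depends on this set, and whether the overlay condition (second clause)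
   holds does not depend on the chosen indexing, up to empty members. *)
Definition overlay_structure (T X : topologicalType) (p : T -> X)
    (C : set (set T)) : Prop :=
  exists (I : Type) (U : I -> set X) (L : I -> Type)
    (V : forall i, L i -> set T),
    [/\ lies_over p U V,
        forall i j (l : L i) (m n : L j),
          V i l `&` V j m !=set0 -> V i l `&` V j n !=set0 -> m = n &
        C = [set A | exists i (l : L i), A = V i l]].

Definition refines (T : Type) (D C : set (set T)) : Prop :=
  forall A, D A -> exists2 B, C B & A `<=` B.

Definition overlay_equiv (T X : topologicalType) (p : T -> X)
    (C D : set (set T)) : Prop :=
  exists E, [/\ overlay_structure p E, refines E C & refines E D].

Definition overlay_class (T X : topologicalType) (p : T -> X)
    (C : set (set T)) : set (set (set T)) :=
  [set D | overlay_structure p D /\ overlay_equiv p C D].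

Definition overlay_classes (T X : topologicalType) (p : T -> X) :
    set (set (set (set T))) :=
  [set overlay_class p C | C in overlay_structure p].

Local Open Scope relation_scope.

(* The fields are those of [Nbhs_isUniform_mixin]: a uniformity on the
   topological space [T] is required to induce the given topology. *)
Record uniformity (T : topologicalType) := Uniformity {
  unif_ent : set_system (T * T);
  unif_filter : Filter unif_ent;
  unif_diagonal : forall A, unif_ent A -> diagonal `<=` A;
  unif_inv : forall A, unif_ent A -> unif_ent A^-1;
  unif_split : forall A, unif_ent A -> exists2 B, unif_ent B & B \; B `<=` A;
  unif_nbhsE : nbhs = nbhs_ unif_ent }.

Local Close Scope relation_scope.

(* [T] regarded as a uniform space via [E]. *)
Definition unif_space (T : topologicalType) (E : uniformity T) : Type := T.

HB.instance Definition _ (T : topologicalType) (E : uniformity T) :=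
  Topological.copy (unif_space E) T.

HB.instance Definition _ (T : topologicalType) (E : uniformity T) :=
  Nbhs_isUniform_mixin.Build (unif_space E) (unif_filter E)
    (@unif_diagonal T E) (@unif_inv T E) (@unif_split T E) (unif_nbhsE E).

(* "p^-1(U) is a disjoint union of homeomorphic copies of U as uniform spaces",
   in the form p^-1(U) ~ U * F over U with F uniformly discrete.  The coproduct of uniform spaces, whose entourages may shrink
   arbitrarily from one summand to another, is not meant. *)
Definition unif_trivial_over (S X : uniformType) (p : S -> X) (U : set X) :
    Prop :=
  exists (F : choiceType)
    (h : p @^-1` U -> (U * discrete_topology F)%type)
    (k : (U * discrete_topology F)%type -> p @^-1` U),
    [/\ unif_continuous h, unif_continuous k, cancel h k, cancel k h &
        forall a : p @^-1` U, val (h a).1 = p (val a)].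

(* As a map between uniform spaces, [p] has to be uniformly continuous.  This
   does not follow from local triviality: give [0,1] * nat the metric for which
   the n-th copy of [0,1] is a circle of length 1 + 1/(n+1) cut open by a gap of
   length 1/(n+1) (and distinct copies are at distance 1).  It is uniformly a
   product over every closed interval of length 1/2, but the projection to
   [0,1] is not uniformly continuous. *)
Definition agrees_with (T : topologicalType) (X : uniformType) (p : T -> X)
    (E : uniformity T) : Prop :=
  unif_continuous (p : unif_space E -> X) /\
  forall x : X, exists U : set X,
    [/\ closed U, nbhs x U & unif_trivial_over (p : unif_space E -> X) U].

Definition agreeing_uniformities (T : topologicalType) (X : uniformType)
    (p : T -> X) : set (set_system (T * T)) :=
  [set unif_ent E | E in agrees_with p].

(* The uniformity induced by a cover [C]: two points are close if they lie in a
   common member of [C] and their images under [p] are close. *)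
Definition overlay_entourage (T : topologicalType) (X : uniformType)
    (p : T -> X) (C : set (set T)) : set_system (T * T) :=
  filter_from (@entourage X) (fun D => [set ab |
    D (p ab.1, p ab.2) /\ exists V, [/\ C V, V ab.1 & V ab.2]]).

(* Main.v *)
Require Import Defs.
From mathcomp Require Import all_boot all_order all_algebra.
From mathcomp Require Import all_classical all_reals all_analysis.

(** An overlay structure C yields the entourages "p a and p b are D-close and a,
    b lie in a common member of C".  For D below a Lebesgue entourage of the
    underlying cover, the overlay condition forces such a, b into one and the
    same sheet, whence the triangle axiom and local triviality; it also shows
    that a refinement of C has the same entourages.  Conversely, cover X by the
    interiors of finitely many closed sets over which a given uniformity is
    trivial.  By finiteness one entourage W separates the sheets over all of
    them, and the sheets over sets B so small that points of one sheet over B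
    are W-close satisfy the overlay condition.  In the same way, two overlay
    structures with equal entourages have a common refinement, so the
    equivalence classes are the fibres of the map from overlay structures to
    uniformities. *)

Local Open Scope classical_set_scope.

Section Overlays.
Set Implicit Arguments.
Unset Strict Implicit.
Unset Printing Implicit Defensive.

(** * Sheets described by points instead of maps between subtypes *)

Lemma nbhs_set_typeP (S : topologicalType) (A : set S) (a : A) (M : set A) :
  nbhs a M <-> exists2 N, nbhs (val a) N & val @^-1` N `<=` M.
Proof.
split=> [[_ [[W oW <-] /= Wa WM]]|[N Na NM]].
  by exists W => //; exact: open_nbhs_nbhs.
by apply: filterS NM _; apply: (@initial_continuous A S set_val).
Qed.

Lemma entourage_set_typeP (S : uniformType) (A : set S) (M : set (A * A)) :
  entourage M <-> exists2 N : set (S * S), entourage N &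
    forall a b : A, N (val a, val b) -> M (a, b).
Proof.
split=> [[N entN NM]|[N entN NM]]; exists N => //.
  by move=> a b Nab; apply: NM.
by case=> a b; apply: NM.
Qed.

(** The second conjunct is continuity of the inverse at [f a]. It can be stated with neighbourhoods
    in all of [T], because values [y] outside [f A] satisfy it vacuously. *)
Lemma restricts_to_homeoP (S T : topologicalType) (f : S -> T)
    (A : set S) (B : set T) : continuous f ->
  restricts_to_homeo f A B <->
  set_bij A B f /\ forall a N, A a -> nbhs a N ->
    \forall y \near f a, forall b, A b -> f b = y -> N b.
Proof.
move=> cf; split=> [[h [k [ch ck hK kK fE]]]|[[fAB finj fsurj] kcont]].
  have toA a (Aa : A a) : exists2 a' : A, val a' = a & val (h a') = f a.
    by exists (exist _ a (mem_set Aa)) => //; rewrite fE.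
  split; first split.
  - by move=> a /toA [a' _ <-]; exact: set_valP.
  - move=> a b /set_mem/toA [a' <- <-] /set_mem/toA [b' <- <-].
    by move=> /val_inj/(can_inj hK) ->.
  - move=> y By; exists (val (k (exist _ y (mem_set By)))).
      exact: set_valP.
    by rewrite -fE kK.
  - move=> _ N /toA [a' <- <-] Na'.
    have /ck : nbhs (k (h a')) (val @^-1` N).
      by rewrite hK; apply/nbhs_set_typeP; exists N.
    move=> /nbhs_set_typeP[W nW WN]; apply: filterS nW => y Wy b /toA [b' <-].
    by move=> <- fb; rewrite -[b']hK; apply: WN; rewrite /= fb.
have [h hE] : {h : A -> B & forall a, val (h a) = f (val a)}.
  apply: (@choice _ _ (fun (a : A) (b : B) => val b = f (val a))) => a.
  by exists (exist _ (f (val a)) (mem_set (fAB _ (set_valP a)))).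
have [k kE] : {k : B -> A & forall b, f (val (k b)) = val b}.
  apply: (@choice _ _ (fun (b : B) (a : A) => f (val a) = val b)) => b.
  by have [a Aa <-] := fsurj _ (set_valP b); exists (exist _ a (mem_set Aa)).
have kinj a b : f (val a) = f (val b) -> a = b :> A.
  by move=> /finj eqab; apply/val_inj/eqab; apply/mem_set/set_valP.
exists h, k; split=> // [a M|b M|a|b].
- move=> /nbhs_set_typeP[N]; rewrite hE => /cf Na NM.
  by apply/nbhs_set_typeP; exists (f @^-1` N) => // c Nc; apply: NM; rewrite /= hE.
- move=> /nbhs_set_typeP[N /(kcont _ _ (set_valP _))]; rewrite kE => Nb NM.
  apply/nbhs_set_typeP; eexists; first exact: Nb.
  by move=> c /= cN; apply/NM/cN; [exact: set_valP|exact: kE].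
- by apply: kinj; rewrite kE hE.
- by apply: val_inj; rewrite hE kE.
Qed.

Lemma entourage_prodP (U V : uniformType) (M : set ((U * V) * (U * V))) :
  entourage M <-> exists2 D : set (U * U), entourage D &
    exists2 D' : set (V * V), entourage D' &
    forall u u' v v', D (u, u') -> D' (v, v') -> M ((u, v), (u', v')).
Proof.
split=> [[[D D'] [/= entD entD'] DM]|[D entD [D' entD' DM]]].
  exists D => //; exists D' => // u u' v v' Du Dv.
  by have [[[? ?] [? ?]] /= + [<- <- <- <-]] := DM ((u, u'), (v, v')) (conj Du Dv).
exists (D, D') => // -[[u u'] [v v']] /= [Du Dv].
by exists ((u, v), (u', v')) => //; exact: DM.
Qed.

(* [Z f] plays the role of U * {f} inside p^-1(U); that the labels [f] are
   uniformly discrete is expressed by the first [\near] clause. *)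
Definition uniform_sheets (S X : uniformType) (p : S -> X) (U : set X)
    (F : Type) (Z : F -> set S) : Prop :=
  [/\ p @^-1` U = \bigcup_f Z f,
      forall f, set_bij (Z f) U p,
      \forall ab \near @entourage S, forall f g, Z f ab.1 -> Z g ab.2 -> f = g &
      forall W, @entourage S W -> \forall xy \near @entourage X,
        forall f a b, Z f a -> Z f b -> p a = xy.1 -> p b = xy.2 -> W (a, b)].

(** The sheets are the fibres of the second coordinate of [h]. Uniform continuity of that coordinate
    is the separation clause, that of the first comes from [p], and that of [k] is the last clause:
    one entourage of [X] serves all labels because the labels are uniformly discrete. *)
Lemma unif_trivial_overP (S X : uniformType) (p : S -> X) (U : set X) :
  unif_continuous p ->
  unif_trivial_over p U <->
  exists (F : Type) (Z : F -> set S), uniform_sheets p U Z.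
Proof.
move=> ucp; split=> [[F [h [k [uch uck hK kK pE]]]]|[F [Z [pUE Zp Zsep Zunif]]]].
  have toU a (Ua : U (p a)) : exists2 a' : p @^-1` U, val a' = a &
      val (h a').1 = p a.
    by exists (exist _ a (mem_set (Ua : (p @^-1` U) a))) => //; rewrite pE.
  exists F, (fun f => [set a | exists2 a' : p @^-1` U, val a' = a & (h a').2 = f]).
  split.
  - apply/seteqP; split=> [a Ua|_ [f _ [a <- _]]]; last exact: set_valP.
    by have [a' <- _] := toU _ Ua; exists (h a').2 => //; exists a'.
  - move=> f; split.
    + by move=> _ [a <- _]; rewrite -pE; exact: set_valP.
    + move=> _ _ /set_mem[a <- haf] /set_mem[b <- hbf]; rewrite -!pE => eqh.
      congr val; apply: (can_inj hK).
      by apply: injective_projections; [exact: val_inj|rewrite haf hbf].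
    + move=> x Ux; pose xf : (U * discrete_topology F)%type :=
        (exist _ x (mem_set Ux), f).
      by exists (val (k xf)); [exists (k xf) => //|rewrite -pE]; rewrite kK.
  - have /uch/entourage_set_typeP[N entN NM] :
        entourage [set xy : (U * discrete_topology F)%type *
          (U * discrete_topology F)%type | xy.1.2 = xy.2.2].
      apply/entourage_prodP; exists setT; first exact: filterT.
      exists [set xy | xy.1 = xy.2] => //.
      by move=> _ [y _ <-].
    apply: filterS entN => ab Nab f g [a aE <-] [b bE <-].
    have /= := NM a b; rewrite aE bE -surjective_pairing; exact.
  - move=> W entW.
    have /uck/entourage_prodP[D1 /entourage_set_typeP[D entD DD1] [D2 entD2 DW]] :
        entourage [set ab : p @^-1` U * p @^-1` U | W (val ab.1, val ab.2)].
      by apply/entourage_set_typeP; exists W.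
    apply: filterS entD => -[x y] Dxy f _ _ [a <- haf] [b <- hbf] /= xE yE.
    rewrite -[a]hK -[b]hK [h a]surjective_pairing [h b]surjective_pairing.
    apply: (DW (h a).1 (h b).1 (h a).2 (h b).2).
      by apply: DD1; rewrite !pE xE yE.
    by apply: entD2; exists f => //; rewrite haf hbf.
(* The labels form an arbitrary type; [{classic F}] gives it the choice structure required by
   [unif_trivial_over]. *)
have [h hE] : {h : p @^-1` U -> (U * discrete_topology {classic F})%type &
    forall a, Z (h a).2 (val a) /\ val (h a).1 = p (val a)}.
  apply: (@choice _ _ (fun (a : p @^-1` U)
    (uf : (U * discrete_topology {classic F})%type) =>
    Z uf.2 (val a) /\ val uf.1 = p (val a))) => a.
  have Ua := set_valP a; have [f _ Zfa] : (\bigcup_f Z f) (val a) by rewrite -pUE.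
  by exists (exist _ (p (val a)) (mem_set Ua), f).
have [k kE] : {k : (U * discrete_topology {classic F})%type -> p @^-1` U &
    forall uf, Z uf.2 (val (k uf)) /\ p (val (k uf)) = val uf.1}.
  apply: (@choice _ _ (fun (uf : (U * discrete_topology {classic F})%type)
    (a : p @^-1` U) => Z uf.2 (val a) /\ p (val a) = val uf.1)) => -[u f] /=.
  have [_ _ psurj] := Zp f; have [a Zfa pa] := psurj _ (set_valP u).
  have Ua : (p @^-1` U) a by rewrite pUE; exists f.
  by exists (exist _ a (mem_set Ua)).
have Zinj f g a b : Z f a -> Z g b -> p a = p b -> f = g -> a = b.
  move=> Zfa Zgb pab fg; have [_ pinj _] := Zp f.
  by apply: pinj => //; apply/mem_set => //; rewrite fg.
have Zdisj f g a : Z f a -> Z g a -> f = g.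
  by have := @entourage_refl S _ a Zsep; exact.
exists {classic F}, h, k; split=> [M|M|a|uf|a].
- move=> /entourage_prodP[D /entourage_set_typeP[N entN ND] [D' entD' DM]].
  apply/entourage_set_typeP.
  exists ([set ab | N (p ab.1, p ab.2)] `&`
    [set ab | forall f g, Z f ab.1 -> Z g ab.2 -> f = g]).
    by apply: filterI => //; exact: ucp.
  move=> a b [Nab Zab] /=; have [Za ha] := hE a; have [Zb hb] := hE b.
  rewrite [h a]surjective_pairing [h b]surjective_pairing; apply: DM.
    by apply: ND; rewrite ha hb.
  by apply: entD'; exists (h a).2 => //; congr pair; exact: Zab.
- move=> /entourage_set_typeP[N entN NM].
  have entD := Zunif _ entN; apply/entourage_prodP.
  exists (fun uv => forall f a b, Z f a -> Z f b -> p a = val uv.1 ->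
      p b = val uv.2 -> N (a, b)).
    by apply/entourage_set_typeP; eexists; first exact: entD.
  exists [set xy | xy.1 = xy.2]; first by move=> _ [y _ <-].
  move=> u v f g Nuv /= fg; apply: NM.
  have [Zu pu] := kE (u, f); have [Zv pv] := kE (v, g).
  by apply: (Nuv f) => //; rewrite fg.
- have [Za ha] := hE a; have [Zk pk] := kE (h a).
  by apply/val_inj/(Zinj _ _ _ _ Zk Za) => //; rewrite pk.
- have [Zk pk] := kE uf; have [Zh ph] := hE (k uf).
  apply: injective_projections; last exact: (Zdisj _ _ _ Zh Zk).
  by apply: val_inj; rewrite ph pk.
- by have [] := hE a.
Qed.


(** * Small sets in uniform spaces *)

Lemma lebesgue_entourage (X : uniformType) (I : Type) (U : I -> set X) :
  compact [set: X] -> (forall i, open (U i)) -> \bigcup_i U i = [set: X] ->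
  exists2 D, entourage D & forall x, exists i, forall y, D (x, y) -> U i y.
Proof.
move=> cX oU Ucov.
pose P (D : set (X * X)) x := exists i, forall y, D (x, y) -> U i y.
(* Near [F] means for all sufficiently small [D], so the near-covering form of compactness turns a
   local choice of [D] into a global one. *)
pose F := filter_from (@entourage X) (fun D => [set D' | D' `<=` D]).
have FF : Filter F.
  apply: filter_from_filter; first by exists setT; exact: filterT.
  move=> D D' entD entD'; exists (D `&` D'); first exact: filterI.
  by move=> D0; rewrite /= subsetI.
suff [D entD DP] : \forall D \near F, [set: X] `<=` P D.
  by exists D => // x; exact: DP.
apply: ((compact_near_coveringP _).1 cX _ _ P) => x _.
have [i _ Uix] : (\bigcup_i U i) x by rewrite Ucov.
have : nbhs x (U i) by exact: open_nbhs_nbhs.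
rewrite -nbhs_entourageE => -[D entD DU].
exists (xsection (split_ent D) x, [set D' | D' `<=` split_ent D]).
  by split; [exact: nbhs_entourage|exists (split_ent D)].
move=> [x' D'] /= [/xsectionP Dxx' D'D]; exists i => y /D'D Dx'y.
by apply/DU/mem_set; exact: entourage_split Dx'y.
Qed.

(** Any two points of the set are compared through [x], which is why the half of [D] is made
    symmetric. *)
Lemma small_open_nbhs (X : uniformType) (D : set (X * X)) (x : X) (N : set X) :
  entourage D -> nbhs x N ->
  exists B, [/\ open B, B x, B `<=` N & B `*` B `<=` D].
Proof.
move=> entD xN; pose S := split_ent D `&` (split_ent D)^-1%relation.
have entS : entourage S by exact: entourage_invI.
exists (N `&` xsection S x)°; split.
- exact: open_interior.
- by apply: filterI => //; exact: nbhs_entourage.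
- by apply: subset_trans (@interior_subset _ _) _ => y [].
- move=> [y z] [/interior_subset[_ /xsectionP[_ yx]]].
  by move=> /interior_subset[_ /xsectionP[xz _]]; exact: entourage_split xz.
Qed.

(** Regularity of uniform spaces, which supplies the closed neighbourhoods asked for in
    [agrees_with]. *)
Lemma closed_nbhs_sub (X : uniformType) (x : X) (N : set X) : nbhs x N ->
  exists K, [/\ closed K, nbhs x K & K `<=` N].
Proof.
rewrite -{1}nbhs_entourageE => -[D entD DN].
exists (closure (xsection (split_ent D) x)); split.
- exact: closed_closure.
- by apply: filterS (@subset_closure _ _) _; exact: nbhs_entourage.
- exact: subset_trans (ent_closure entD) DN.
Qed.

(** * From overlay structures to uniformities *)

Lemma lies_over_restrict (T X : topologicalType) (p : T -> X) (I J : Type)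
    (U : I -> set X) (L : I -> Type) (V : forall i, L i -> set T)
    (N : J -> I) (B : J -> set X) :
  continuous p -> lies_over p U V ->
  (forall j, open (B j)) -> \bigcup_j B j = [set: X] ->
  (forall j, B j `<=` U (N j)) ->
  lies_over p B (fun j l => V (N j) l `&` p @^-1` B j).
Proof.
move=> cp [_ oV VU Vtriv Vhomeo] oB Bcov BU; split=> //.
- by move=> j l; apply: openI => //; exact: (continuousP p).1.
- move=> j; apply/seteqP; split=> [a Ba|a [l _ []] //].
  have [l _ Va] : (\bigcup_l V (N j) l) a by rewrite -VU; exact: BU.
  by exists l.
- by move=> j l m _ _ [a [[Vl _] [Vm _]]]; apply: (Vtriv (N j)) => //; exists a.
- move=> j l; apply/restricts_to_homeoP => //.
  have /(restricts_to_homeoP _ _ cp)[[_ pinj psurj] pcont] := Vhomeo (N j) l.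
  split; first split.
  + by move=> a [].
  + by move=> a b /set_mem[Va _] /set_mem[Vb _]; apply: pinj; exact/mem_set.
  + move=> x Bx; have [a Va pa] := psurj _ (BU _ _ Bx).
    by exists a => //; split=> //; rewrite /= pa.
  + move=> a M [Va _] /(pcont _ _ Va); apply: filterS => x xP b [Vb _].
    exact: xP.
Qed.

(** The overlay condition as it is used below. If [b] lies in [V i n] and shares with [a] a member
    of [C], then that member meets both [V i l] and [V i n], so [n = l]. *)
Lemma overlay_structureP (T X : topologicalType) (p : T -> X)
    (C : set (set T)) : overlay_structure p C ->
  exists (I : Type) (U : I -> set X) (L : I -> Type)
    (V : forall i, L i -> set T),
    [/\ lies_over p U V,
        forall i l a b, V i l a -> U i (p b) ->
          (exists A, [/\ C A, A a & A b]) -> V i l b &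
        C = [set A | exists i (l : L i), A = V i l]].
Proof.
move=> [I [U [L [V [pUV Vov CE]]]]]; exists I, U, L, V; split=> //.
move=> i l a b Va Ub [A []]; rewrite CE => -[j [m ->]] Aa Ab.
have [_ _ VU _ _] := pUV.
have [n _ Vb] : (\bigcup_n V i n) b by rewrite -VU.
by rewrite (Vov j i m l n) //; [exists a|exists b].
Qed.

Section OverlayEntourage.
Variables (X : uniformType) (T : topologicalType) (p : T -> X).
Variable (C : set (set T)).
Hypotheses (cX : compact [set: X]) (cp : continuous p).
Hypothesis ovC : overlay_structure p C.

Lemma overlay_structure_cover a : exists2 A, C A & A a.
Proof.
have [I [U [L [V [[[_ Ucov] _ VU _ _] _ CE]]]]] := overlay_structureP ovC.
have [i _ Ua] : (\bigcup_i U i) (p a) by rewrite Ucov.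
have [l _ Va] : (\bigcup_l V i l) a by rewrite -VU.
by exists (V i l) => //; rewrite CE; exists i, l.
Qed.

Lemma overlay_entourage_filter : Filter (overlay_entourage p C).
Proof.
apply: filter_from_filter; first by exists setT; exact: filterT.
move=> D D' entD entD'; exists (D `&` D'); first exact: filterI.
by move=> ab [[Dab D'ab] ?].
Qed.

Lemma overlay_entourage_diagonal A :
  overlay_entourage p C A -> diagonal `<=` A.
Proof.
move=> [D entD DA] [a b] /diagonalP <-; apply: DA => /=.
by split; [exact: entourage_refl|have [V] := overlay_structure_cover a; exists V].
Qed.

Lemma overlay_entourage_inv A :
  overlay_entourage p C A -> overlay_entourage p C A^-1%relation.
Proof.
move=> [D entD DA]; exists D^-1%relation; first exact: entourage_inv.
by move=> [a b] /= [Dba [V [CV Va Vb]]]; apply: DA; split=> //; exists V.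
Qed.

Lemma overlay_entourage_split A : overlay_entourage p C A ->
  exists2 B, overlay_entourage p C B & (B \; B)%relation `<=` A.
Proof.
move=> [D entD DA].
have [I [U [L [V [pUV Vsame CE]]]]] := overlay_structureP ovC.
have [[oU Ucov] _ VU _ _] := pUV.
have [D1 entD1 D1U] := lebesgue_entourage cX oU Ucov.
have entD2 : entourage (D `&` D1) by exact: filterI.
(* Halving [D1] as well keeps the images of [b] and [c] in the set [U i] around [p a]; the sheet of
   [a] then contains first [b] and then [c]. *)
pose D' := split_ent (D `&` D1).
exists [set ab | D' (p ab.1, p ab.2) /\ exists V, [/\ C V, V ab.1 & V ab.2]].
  by exists D' => //; exact: entourage_split_ent.
move=> [a c] [b /= [D'ab ab] [D'bc bc]].
have [Dac D1ac] := entourage_split _ entD2 D'ab D'bc.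
have [_ D1ab] := split_ent_subset entD2 D'ab.
have [i iU] := D1U (p a).
have Ua : (p @^-1` U i) a by apply: iU; exact: entourage_refl.
have [l _ Va] : (\bigcup_l V i l) a by rewrite -VU.
have Vb := Vsame _ _ _ _ Va (iU _ D1ab) ab.
have Vc := Vsame _ _ _ _ Vb (iU _ D1ac) bc.
by apply: DA; split=> //; exists (V i l); rewrite CE; split=> //; exists i, l.
Qed.

Lemma overlay_entourage_nbhsE : nbhs = nbhs_ (overlay_entourage p C).
Proof.
have [I [U [L [V [[[oU Ucov] oV VU _ Vhomeo] Vsame CE]]]]] :=
  overlay_structureP ovC.
rewrite predeq2E => x A.
have [i _ Ux] : (\bigcup_i U i) (p x) by rewrite Ucov.
have [l _ Vx] : (\bigcup_l V i l) x by rewrite -VU.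
split=> [|[M [D entD DM] MA]].
  have /(restricts_to_homeoP _ _ cp)[_ pcont] := Vhomeo i l.
  move=> /(pcont _ _ Vx) nA.
  have nU : nbhs (p x) (U i) by exact: open_nbhs_nbhs.
  (* The factor [U i] allows [Vsame] to bring a point close to [x] into the sheet of [x], where the
     first factor applies. *)
  have : nbhs (p x) ([set y | forall b, V i l b -> p b = y -> A b] `&` U i).
    exact: filterI.
  rewrite -nbhs_entourageE => -[D entD DA].
  exists [set ab | D (p ab.1, p ab.2) /\ exists V, [/\ C V, V ab.1 & V ab.2]].
    by exists D.
  move=> b /xsectionP[/= Dxb xb].
  have [+ Ub] := DA (p b) (mem_set Dxb).
  by apply=> //; exact: Vsame xb.
have nV : nbhs x (V i l) by exact: open_nbhs_nbhs.
have nD : nbhs x (p @^-1` xsection D (p x)) by apply: cp; exact: nbhs_entourage.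
apply: filterS (filterI nV nD) => b [Vb /xsectionP Db].
apply/MA/mem_set/DM; split=> //.
by exists (V i l); rewrite CE; split=> //; exists i, l.
Qed.

Definition overlay_uniformity : uniformity T :=
  Uniformity overlay_entourage_filter overlay_entourage_diagonal
    overlay_entourage_inv overlay_entourage_split overlay_entourage_nbhsE.

Lemma overlay_uniformity_agrees : agrees_with p overlay_uniformity.
Proof.
have ucp : unif_continuous (p : unif_space overlay_uniformity -> X).
  by move=> D entD; exists D => // ab [].
split=> // x.
have [I [U [L [V [[[oU Ucov] oV VU Vtriv Vhomeo] Vsame CE]]]]] :=
  overlay_structureP ovC.
have [i _ Ux] : (\bigcup_i U i) x by rewrite Ucov.
have /closed_nbhs_sub[K [cK xK KU]] : nbhs x (U i) by exact: open_nbhs_nbhs.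
exists K; split=> //; apply/unif_trivial_overP => //.
exists (L i), (fun l => V i l `&` p @^-1` K); split.
- apply/seteqP; split=> [a Ka|a [l _ []] //].
  have [l _ Va] : (\bigcup_l V i l) a by rewrite -VU; exact: KU.
  by exists l.
- move=> l; have /(restricts_to_homeoP _ _ cp)[[_ pinj psurj] _] := Vhomeo i l.
  split.
  + by move=> a [].
  + by move=> a b /set_mem[Va _] /set_mem[Vb _]; apply: pinj; exact/mem_set.
  + move=> y Ky; have [a Va pa] := psurj _ (KU _ Ky).
    by exists a => //; split=> //; rewrite /= pa.
(* No closeness in [X] is required: over [K], sharing a member of [C] already forces equal
   sheets. *)
- exists setT; first exact: filterT.
  move=> [a b] [_ /= ab] f g [Va _] [Vb Kb].
  apply: (Vtriv i) => //; exists b; split=> //.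
  by apply: Vsame Va _ ab; exact: KU.
(* A sheet over [U i] is itself a member of [C], so the same [D] works for every label. *)
- move=> W [D entD DW]; apply: filterS entD => -[y z] Dyz f a b [Va _] [Vb _].
  move=> pa pb; apply: DW; rewrite /= pa pb; split=> //.
  by exists (V i f); rewrite CE; split=> //; exists i, f.
Qed.

End OverlayEntourage.

(** * Equivalence of overlay structures *)

Lemma overlay_restrict (T X : topologicalType) (p : T -> X) (I J : Type)
    (U : I -> set X) (L : I -> Type) (V : forall i, L i -> set T)
    (N : J -> I) (B : J -> set X) :
  continuous p -> lies_over p U V ->
  (forall j, open (B j)) -> \bigcup_j B j = [set: X] ->
  (forall j, B j `<=` U (N j)) ->
  (forall j k l m n, 
     (V (N j) l `&` p @^-1` B j) `&` V (N k) m !=set0 ->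
     (V (N j) l `&` p @^-1` B j) `&` V (N k) n !=set0 -> m = n) ->
  overlay_structure p [set A | exists j l, A = V (N j) l `&` p @^-1` B j].
Proof.
move=> cp pUV oB Bcov BU Vov.
exists J, B, (fun j => L (N j)), (fun j l => V (N j) l `&` p @^-1` B j).
split=> //; first exact: lies_over_restrict pUV _ _ _.
move=> j k l m n [a [aj [am _]]] [b [bj [bn _]]].
by apply: (Vov j k l); [exists a|exists b].
Qed.

(** Sharing a member of [D] implies sharing one of [C]. Conversely, let [a] and [b] share a member
    of [C], with [p b] in the base of a sheet [V] of [D] through [a]. Let [c] be the point of [V]
    over [p b]. The sheet of [C] around [V] contains [b] as well as [c], and [p] is injective on it,
    so [b = c] lies in [V]. *)
Lemma overlay_entourage_refines (X : uniformType) (T : topologicalType)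
    (p : T -> X) (C D : set (set T)) :
  compact [set: X] -> continuous p ->
  overlay_structure p C -> overlay_structure p D -> refines D C ->
  overlay_entourage p D = overlay_entourage p C.
Proof.
move=> cX cp ovC ovD DC; apply/seteqP; split=> M [W entW WM]; last first.
  exists W => // ab [Wab [V [/DC[V' CV' VV'] Va Vb]]].
  by apply: WM; split=> //; exists V'; split=> //; exact: VV'.
have [I [U [L [V [pUV _ DE]]]]] := overlay_structureP ovD.
have [[oU Ucov] _ VU _ Vhomeo] := pUV.
have [I' [U' [L' [V' [[_ _ V'U' _ V'homeo] V'same CE]]]]] :=
  overlay_structureP ovC.
have [W1 entW1 W1U] := lebesgue_entourage cX oU Ucov.
exists (W `&` W1); first exact: filterI.
move=> [a b] /= [[Wab W1ab] ab]; apply: WM; split=> //.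
have [i iU] := W1U (p a).
have Ua : (p @^-1` U i) a by apply: iU; exact: entourage_refl.
have [l _ Va] : (\bigcup_l V i l) a by rewrite -VU.
have DV : D (V i l) by rewrite DE; exists i, l.
exists (V i l); split=> //.
have [A + VA] := DC _ DV; rewrite CE => -[i' [l' AE]]; rewrite {A}AE in VA.
have /(restricts_to_homeoP _ _ cp)[[_ _ psurj] _] := Vhomeo i l.
have /(restricts_to_homeoP _ _ cp)[[_ pinj' _] _] := V'homeo i' l'.
have [c Vc pc] := psurj _ (iU _ W1ab).
have V'c := VA _ Vc.
have U'b : U' i' (p b).
  rewrite -pc; suff : (p @^-1` U' i') c by [].
  by rewrite V'U'; exists l'.
have V'b := V'same _ _ _ _ (VA _ Va) U'b ab.
by rewrite -(pinj' c b) //; exact/mem_set.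
Qed.

Lemma overlay_equivP (X : uniformType) (T : topologicalType)
    (p : T -> X) (C D : set (set T)) :
  compact [set: X] -> continuous p ->
  overlay_structure p C -> overlay_structure p D ->
  overlay_equiv p C D <-> overlay_entourage p C = overlay_entourage p D.
Proof.
move=> cX cp ovC ovD; split=> [[E [ovE EC ED]]|CD].
  rewrite -(overlay_entourage_refines cX cp ovC ovE EC).
  exact: overlay_entourage_refines.
(* Equality of the two uniformities is used for this one entourage: it yields a [W] such that points
   of a common member of [C] with [W]-close images share a member of [D]. *)
have : overlay_entourage p D [set ab | exists V, [/\ D V, V ab.1 & V ab.2]].
  by exists setT; [exact: filterT|move=> ab []].
rewrite -CD => -[W entW WD].
have [I' [U' [L' [V' [[[oU' U'cov] _ V'U' _ _] V'same DE]]]]] :=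
  overlay_structureP ovD.
have [I [U [L [V [pUV Vov CE]]]]] := ovC.
have [[oU Ucov] _ VU _ Vhomeo] := pUV.
have [NB NBP] : {NB : X -> I * set X & forall x, [/\ open (NB x).2, (NB x).2 x,
    (NB x).2 `<=` U (NB x).1, (NB x).2 `*` (NB x).2 `<=` W &
    exists j, (NB x).2 `<=` U' j]}.
  apply: (@choice _ _ (fun x (NB : I * set X) => [/\ open NB.2, NB.2 x,
    NB.2 `<=` U NB.1, NB.2 `*` NB.2 `<=` W & exists j, NB.2 `<=` U' j])) => x.
  have [i _ Ux] : (\bigcup_i U i) x by rewrite Ucov.
  have [j _ U'x] : (\bigcup_i U' i) x by rewrite U'cov.
  have xUU' : nbhs x (U i `&` U' j).
    by apply: filterI; exact: open_nbhs_nbhs.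
  have [B [oB Bx BUU' BW]] := small_open_nbhs entW xUU'.
  by exists (i, B); split=> //=; [|exists j] => y /BUU' [].
pose N x := (NB x).1; pose B x := (NB x).2.
have oB x : open (B x) by have [] := NBP x.
have Bx x : B x x by have [] := NBP x.
have BU x : B x `<=` U (N x) by have [] := NBP x.
(* The common refinement consists of the sheets of [C] cut down to the small sets [B x]. *)
exists [set A | exists x l, A = V (N x) l `&` p @^-1` B x]; split.
- apply: (overlay_restrict cp pUV) => //.
    by apply/seteqP; split=> // x _; exists x.
  move=> x y l m n [a [[Va _] Vma]] [b [[Vb _] Vnb]].
  by apply: (Vov (N x) (N y) l); [exists a|exists b].
- move=> _ [x [l ->]]; exists (V (N x) l); last by move=> ? [].
  by rewrite CE; exists (N x), l.
- move=> _ [x [l ->]]; have [_ _ _ BW [j BU'j]] := NBP x.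
  have /(restricts_to_homeoP _ _ cp)[[_ _ psurj] _] := Vhomeo (N x) l.
  (* The sheet of [D] through the point [a] over the centre [x] contains the whole cut sheet: each
     [b] there has its image [W]-close to [p a], hence shares a member of [D] with [a]. *)
  have [a Va pa] := psurj _ (BU _ _ (Bx x)).
  have [m _ V'a] : (\bigcup_m V' j m) a.
    by rewrite -V'U' /= pa; exact: BU'j (Bx x).
  exists (V' j m); first by rewrite DE; exists j, m.
  move=> b [Vb Bb]; apply: (V'same j m a b) => //; first exact: BU'j.
  apply: (WD (a, b)) => /=; split.
    by apply: BW; rewrite pa; split=> //=; exact: Bx.
  by exists (V (N x) l); rewrite CE; split=> //; exists (N x), l.
Qed.

(** * From uniformities to overlay structures *)

Lemma compact_finite_nbhs_cover (X : topologicalType) (N : X -> set X) :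
  compact [set: X] -> (forall x, nbhs x (N x)) ->
  exists s : seq X, forall y : X, exists2 x, x \in s & nbhs y (N x).
Proof.
move=> cX xN.
(* Near [F] means for all sufficiently large finite sequences. *)
pose F := filter_from [set: seq X] (fun s => [set t : seq X | {subset s <= t}]).
have FF : Filter F.
  apply: filter_from_filter; first by exists [::].
  move=> s t _ _; exists (s ++ t) => // u stu.
  by split=> x xs; apply: stu; rewrite mem_cat xs ?orbT.
pose P (s : seq X) (y : X) := exists2 x, x \in s & nbhs y (N x).
suff [s _ sP] : \forall s \near F, [set: X] `<=` P s.
  by exists s => y; apply: (sP s).
apply: ((compact_near_coveringP _).1 cX _ _ P) => // x _.
exists ((N x)°, [set s | x \in s]) => /=.
  split; first exact: nbhs_interior.
  by exists [:: x] => // s; apply; rewrite mem_head.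
by move=> [y s] /= [Ny xs]; exists x.
Qed.

Lemma filter_forall_seq (T : Type) (I : eqType) (F : set_system T) (s : seq I)
    (P : I -> set T) : Filter F -> (forall i, F (P i)) ->
  \forall t \near F, forall i, i \in s -> P i t.
Proof.
move=> FF FP; elim: s => [|i s IHs]; first exact: nearW.
apply: filterS (filterI (FP i) IHs) => t [Pit Pst] j.
by rewrite inE => /predU1P[->|/Pst].
Qed.

(** Sheets are open because points close enough to [a] cannot carry another label; the inverse of
    [p] on a sheet is continuous by the last clause of [uniform_sheets]. Interiors make the base
    cover open. *)
Lemma uniform_sheets_lies_over (S X : uniformType) (p : S -> X) (I : Type)
    (K : I -> set X) (F : I -> Type) (Z : forall i, F i -> set S) :
  continuous p -> \bigcup_i (K i)° = [set: X] ->
  (forall i, uniform_sheets p (K i) (@Z i)) ->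
  lies_over p (fun i => (K i)°) (fun i f => Z i f `&` p @^-1` (K i)°).
Proof.
move=> cp Kcov pZ.
have oK i : open (K i)° by exact: open_interior.
split=> //.
- move=> i f; rewrite openE => a [Za Ka]; have [ZE _ Zsep _] := pZ i.
  have Kb : nbhs a (p @^-1` (K i)°) by apply: cp; exact: open_nbhs_nbhs.
  apply: filterS (filterI Kb (nbhs_entourage a Zsep)) => b [Kpb /xsectionP ab].
  split=> //; have [g _ Zb] : (\bigcup_f Z i f) b.
    by rewrite -ZE; exact: interior_subset Kpb.
  by rewrite (ab f g).
- move=> i; have [ZE _ _ _] := pZ i; apply/seteqP; split=> [a Ka|a [f _ []] //].
  have [f _ Za] : (\bigcup_f Z i f) a by rewrite -ZE; exact: interior_subset Ka.
  by exists f.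
- move=> i f g _ _ [a [[Zf _] [Zg _]]]; have [_ _ Zsep _] := pZ i.
  exact: (@entourage_refl S _ a Zsep).
- move=> i f; apply/restricts_to_homeoP => //; have [_ Zp _ Zunif] := pZ i.
  have [_ pinj psurj] := Zp f; split; first split.
  + by move=> a [].
  + by move=> a b /set_mem[Za _] /set_mem[Zb _]; apply: pinj; exact/mem_set.
  + move=> x Kx; have [a Za pa] := psurj _ (interior_subset Kx).
    by exists a => //; split=> //; rewrite /= pa.
  + move=> a M [Za _]; rewrite -nbhs_entourageE => -[W entW WM].
    apply: filterS (nbhs_entourage (p a) (Zunif _ entW)) => x /xsectionP ax.
    by move=> b [Zb _] pb; apply/WM/mem_set; exact: (ax f).
Qed.

Lemma uniform_sheets_overlay (S X : uniformType) (p : S -> X) :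
  compact [set: X] -> continuous p -> unif_continuous p ->
  (forall x : X, exists2 U, nbhs x U & unif_trivial_over p U) ->
  exists2 C, overlay_structure p C & overlay_entourage p C = entourage.
Proof.
move=> cX cp ucp ploc.
(* Neighbourhood, labels and sheets are chosen together as a dependent sum, since the type of the
   sheets depends on the chosen labels. *)
have [KZ KZP] : {KZ : X -> {K : set X & {F : Type & F -> set S}} & forall x,
    nbhs x (projT1 (KZ x)) /\
    uniform_sheets p (projT1 (KZ x)) (projT2 (projT2 (KZ x)))}.
  apply: (@choice _ _ (fun x (KZ : {K : set X & {F : Type & F -> set S}}) =>
    nbhs x (projT1 KZ) /\
    uniform_sheets p (projT1 KZ) (projT2 (projT2 KZ)))) => x.
  have [K xK /unif_trivial_overP[//|F [Z pZ]]] := ploc x.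
  by exists (existT _ K (existT _ F Z)).
pose K x := projT1 (KZ x); pose F x := projT1 (projT2 (KZ x)).
pose Z x : F x -> set S := projT2 (projT2 (KZ x)).
have xK x : nbhs x (K x) by have [] := KZP x.
have pZ x : uniform_sheets p (K x) (Z x) by have [] := KZP x.
have {KZP} [s sK] := compact_finite_nbhs_cover cX xK.
(* Restricting to [x \in s] leaves a finite intersection of entourages, so one [W] separates sheets
   over all these sets; [Zunif] obtains its [D] in the same way. *)
have [W entW WZ] : exists2 W, entourage W & forall a b, W (a, b) ->
    forall x, x \in s -> forall f g, Z x f a -> Z x g b -> f = g.
  eexists; first apply: (@filter_forall_seq _ _ _ s
    (fun x => [set ab | forall f g, Z x f ab.1 -> Z x g ab.2 -> f = g])).
    by move=> x; have [] := pZ x.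
  by move=> a b ab x /ab.
have Zunif M : entourage M -> exists2 D, entourage D & forall x f a b, x \in s ->
    Z x f a -> Z x f b -> D (p a, p b) -> M (a, b).
  move=> entM; eexists; first apply: (@filter_forall_seq _ _ _ s
    (fun x => [set xy | forall f a b, Z x f a -> Z x f b ->
      p a = xy.1 -> p b = xy.2 -> M (a, b)])).
    by move=> x; have [_ _ _] := pZ x; exact.
  by move=> x f a b xs Za Zb /(_ _ xs f); exact.
(* Over a [D]-small base set, the points of one sheet are pairwise [W]-close. *)
have [D entD DW] := Zunif _ entW.
have [NB NBP] : {NB : X -> X * set X & forall x, [/\ open (NB x).2, (NB x).2 x,
    (NB x).2 `<=` (K (NB x).1)°, (NB x).2 `*` (NB x).2 `<=` D & (NB x).1 \in s]}.
  apply: (@choice _ _ (fun x (NB : X * set X) => [/\ open NB.2, NB.2 x,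
    NB.2 `<=` (K NB.1)°, NB.2 `*` NB.2 `<=` D & NB.1 \in s])) => x.
  have [y ys /nbhs_interior Kx] := sK x.
  by have [B [? ? ? ?]] := small_open_nbhs entD Kx; exists (y, B).
pose N x := (NB x).1; pose B x := (NB x).2.
have oB x : open (B x) by have [] := NBP x.
have Bx x : B x x by have [] := NBP x.
have BK x : B x `<=` (K (N x))° by have [] := NBP x.
have BD x : B x `*` B x `<=` D by have [] := NBP x.
have Ns x : N x \in s by have [] := NBP x.
have Bcov : \bigcup_x B x = [set: X] by apply/seteqP; split=> // x _; exists x.
have Kcov : \bigcup_x (K x)° = [set: X].
  by apply/seteqP; split=> // x _; exists x => //; exact: xK.
pose V x (f : F x) := Z x f `&` p @^-1` (K x)°.
have pKV : lies_over p (fun x => (K x)°) V by exact: uniform_sheets_lies_over.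
exists [set A | exists x f, A = V (N x) f `&` p @^-1` B x].
  apply: (overlay_restrict cp pKV) => //.
  (* Both [a] and [b] lie in one sheet over [B x], so they are [W]-close, and [W] separates the
     sheets over [K (N y)]. *)
  move=> x y l m n [a [[[Za _] Ba] [Zma _]]] [b [[[Zb _] Bb] [Znb _]]].
  apply: (WZ a b) Zma Znb => //.
  by apply: (DW _ _ _ _ (Ns x) Za Zb); apply: (BD x).
apply/seteqP; split=> [M [D0 entD0 D0M]|M /Zunif[D0 entD0 D0M]].
  have [D1 entD1 D1B] := lebesgue_entourage cX oB Bcov.
  have entD01 : entourage (D0 `&` D1) by exact: filterI.
  (* The Lebesgue entourage [D1] puts both images into one [B x], and [W]-closeness then puts [a]
     and [b] into one sheet over it. *)
  apply: filterS (filterI entW (ucp _ entD01)) => -[a b] [/WZ ab [/= D0ab D1ab]].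
  apply: D0M; split=> //.
  have [x xB] := D1B (p a); have Bb := xB _ D1ab.
  have Ba : B x (p a) by apply: xB; exact: entourage_refl.
  have [ZE _ _ _] := pZ (N x).
  have Zcov c : B x (p c) -> exists f, Z (N x) f c.
    move=> /BK/interior_subset Kc.
    have [f _ Zc] : (\bigcup_f Z (N x) f) c by rewrite -ZE.
    by exists f.
  have [[f Za] [g Zb]] := (Zcov _ Ba, Zcov _ Bb).
  have fg := ab _ (Ns x) _ _ Za Zb; rewrite -{g}fg in Zb.
  exists (V (N x) f `&` p @^-1` B x).
  by split; [exists x, f| |]; split=> //; split=> //; exact: BK.
exists D0 => // -[a b] /= [Dab [_ [[x [f ->]] [[Za _] _] [[Zb _] _]]]].
exact: (D0M _ _ _ _ (Ns x) Za Zb Dab).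
Qed.
End Overlays.

(** * The bijection on equivalence classes *)

Theorem theorem7p6 (R : realType) (X : metricType R) (T : topologicalType)
    (p : T -> X) (compactX : compact [set: X]) (covp : covering_map p) :
  exists Phi : set (set (set T)) -> set_system (T * T),
    set_bij (overlay_classes p) (agreeing_uniformities p) Phi /\
    forall C : set (set T), overlay_structure p C ->
      Phi (overlay_class p C) = overlay_entourage p C.
Proof.
have [cp _] := covp.
(* [Phi] evaluates a chosen representative. The default [set0] is not reached on the class of an
   overlay structure [C], which contains [C]; independence of the choice is [overlay_equivP]. *)
pose Phi (K : set (set (set T))) := overlay_entourage p (xget set0 K).
have PhiE C : overlay_structure p C ->
    Phi (overlay_class p C) = overlay_entourage p C.
  move=> ovC; have /(xgetPex set0)[ovD] : exists D, overlay_class p C D.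
    by exists C; split=> //; exact/overlay_equivP.
  by move=> /(overlay_equivP compactX cp ovC ovD) ->.
exists Phi; split=> //; split.
- move=> _ [C ovC <-]; rewrite PhiE //.
  exists (overlay_uniformity compactX cp ovC) => //.
  exact: overlay_uniformity_agrees.
- move=> _ _ /set_mem[C ovC <-] /set_mem[D ovD <-]; rewrite !PhiE // => CD.
  apply/seteqP; split=> E [ovE eqE]; split=> //; move: eqE.
    by move=> /overlay_equivP CE; apply/overlay_equivP => //; rewrite -CD CE.
  by move=> /overlay_equivP DE; apply/overlay_equivP => //; rewrite CD DE.
- move=> _ [E [ucp ploc] <-].
  have [|C ovC CE] := @uniform_sheets_overlay (unif_space E) X p compactX cp ucp.
    by move=> x; have [U [_ xU pU]] := ploc x; exists U.
  exists (overlay_class p C); first by exists C.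
  by rewrite PhiE.
Qed.
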